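(* Let $G$ be a countable discrete group. Then $G$ is amenable at infinity if and only if $G$ admits an amenable action by homeomorphisms on the Cantor set $D^{\aleph_0}=\{0,1\}^{\aleph_0}$.
   Context: For a countable discrete group $G$, $\mathcal{P}(G)$ denotes the space of probability measures on $G$ (identified with the functions $p:G\to[0,1]$ with $\sum_{h\in G}p(h)=1$, a subset of $\ell^1(G)$), equipped with the vague topology; $G$ acts on $\mathcal{P}(G)$ by left translation, $(gp)(h)=p(g^{-1}h)$, and $\|\cdot\|_1$ is the $\ell^1$-norm. An action of $G$ by homeomorphisms on a (nonempty) compact Hausdorff space $X$ is called amenable if there exists a sequence of continuous maps $b^n:X\to\mathcal{P}(G)$, $x\mapsto b^n_x$, such that for every $g\in G$, $\lim_{n\to\infty}\sup_{x\in X}\|g b^n_x-b^n_{gx}\|_1=0$. A countable discrete group $G$ is called amenable at infinity (or topologically amenable) if there exist a (nonempty) compact Hausdorff space $X$ and an amenable action of $G$ on $X$ by homeomorphisms. *)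

(* Defs.v *)
From HB Require Import structures.
From mathcomp Require Import all_boot all_order all_algebra.
From mathcomp Require Import all_classical all_reals all_analysis.

Set Implicit Arguments.
Unset Strict Implicit.
Unset Printing Implicit Defensive.

Import Order.TTheory GRing.Theory Num.Theory.
Import numFieldNormedType.Exports.

Local Open Scope classical_set_scope.
Local Open Scope ring_scope.

Record prob_measure (R : realType) (G : groupType) := ProbMeasure {
  pmass :> G -> R ;
  pmass_itv : forall h, 0 <= pmass h <= 1 ;
  pmass_sum : (\esum_(h in [set: G]) (pmass h)%:E = 1)%E }.

HB.instance Definition _ (R : realType) (G : groupType) :=
  gen_eqMixin (prob_measure R G).
HB.instance Definition _ (R : realType) (G : groupType) :=
  gen_choiceMixin (prob_measure R G).

(* C_c(G): since G is discrete, every function is continuous and the compact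
   subsets are the finite ones. *)
Definition Cc (R : realType) (G : groupType) : Type :=
  {f : G -> R | finite_set [set h | f h != 0]}.

Definition pairing (R : realType) (G : groupType)
    (p : prob_measure R G) : prod_topology (fun _ : Cc R G => R) :=
  fun f => \sum_(h \in [set: G]) sval f h * p h.

(* The vague topology is the coarsest one making every p |-> \int f dp with
   f in C_c(G) continuous, i.e. the topology induced by [pairing] from the
   product topology. *)
HB.instance Definition _ (R : realType) (G : groupType) :=
  Topological.copy (prob_measure R G) (initial_topology (@pairing R G)).

Section Translation.
Variables (R : realType) (G : groupType) (g : G) (p : prob_measure R G).

Let ltrans (h : G) : R := p (g^-1 * h)%g.

Let ltrans_itv h : 0 <= ltrans h <= 1.
Proof. exact: pmass_itv. Qed.

Let ltrans_sum : (\esum_(h in [set: G]) (ltrans h)%:E = 1)%E.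
Proof.
rewrite -(pmass_sum p); apply/esym.
rewrite (@reindex_esum R G G [set: G] [set: G] (fun h => g^-1 * h)%g)//.
split=> // [x y _ _|y _]; first exact: mulgI.
by exists (g * y)%g => //; rewrite mulKg.
Qed.

Definition translate : prob_measure R G := ProbMeasure ltrans_itv ltrans_sum.

End Translation.

Definition l1norm (R : realType) (G : groupType) (f : G -> R) : \bar R :=
  (\esum_(h in [set: G]) `|f h|%:E)%E.

Definition homeomorphism (X Y : topologicalType) (f : X -> Y) : Prop :=
  continuous f /\
  exists f' : Y -> X, [/\ continuous f', cancel f f' & cancel f' f].

Definition action_by_homeomorphisms (G : groupType) (X : topologicalType)
    (act : G -> X -> X) : Prop :=
  [/\ forall x, act 1%g x = x,
      forall g h x, act (g * h)%g x = act g (act h x)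
    & forall g, homeomorphism (act g)].

Definition amenable_action (R : realType) (G : groupType) (X : topologicalType)
    (act : G -> X -> X) : Prop :=
  exists b : nat -> X -> prob_measure R G,
    (forall n, continuous (b n)) /\
    (forall g : G,
      (fun n => ereal_sup
        [set l1norm (fun h => translate g (b n x) h - b n (act g x) h)
           | x in [set: X]]) @ \oo --> (0 : \bar R)%E).

Definition amenable_at_infinity (R : realType) (G : groupType) : Prop :=
  exists (X : topologicalType) (act : G -> X -> X),
    [/\ [set: X] !=set0, compact [set: X], hausdorff_space X,
        action_by_homeomorphisms act & amenable_action R act].

(* Main.v *)
(* Along one orbit, an amenable action gives functions b^n : G -> P(G) that are
   almost equivariant.  By compactness of X and Scheffe's lemma their values are
   within 1/(n+1) of finitely many measures, so b^n may be taken finitely valued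
   up to an error that vanishes in the limit, and a finitely valued function is
   recorded by bits.  Thus the b^n are a point of {0,1}^(G x nat x nat), on which
   G acts by right translation of the first coordinate.  The points that are
   almost equivariant with the same errors form a closed invariant set, on which
   evaluation at 1 is an amenability sequence.  For given g and n only finitely
   many bits are read, so the other ones are free, the set has no isolated point,
   and Brouwer's theorem identifies it with the Cantor set. *)
From HB Require Import structures.
Require Import Defs.
From mathcomp Require Import all_boot all_order all_algebra finmap.
From mathcomp Require Import all_classical all_reals all_analysis.
From mathcomp Require Import lra.

Import Order.TTheory GRing.Theory Num.Theory.
Import numFieldNormedType.Exports.

Local Open Scope classical_set_scope.
Local Open Scope ring_scope.

(** * Product and subspace topologies, and Brouwer's theorem *)

(* Unlike [proj_continuous], this does not ask for an eqType of indices. *)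
Lemma prod_topology_proj_continuous (I : Type) (K : I -> topologicalType)
    (i : I) : continuous (proj i : prod_topology K -> K i).
Proof.
move=> f U Ufi; have /cvg_sup/(_ i) : f --> f by exact: cvg_id.
apply; exact: (@initial_continuous _ _ (fun g : prod_topology K => g i)).
Qed.

Lemma cvg_prod_topology (I : Type) (K : I -> topologicalType)
    (F : set_system (prod_topology K)) (f : prod_topology K) :
  Filter F -> (forall i, proj i @ F --> f i) -> F --> f.
Proof.
move=> FF Ff; apply/cvg_sup => i U [_ [[V oV <-] Vfi /filterS]]; apply.
by apply: (Ff i V); exact: open_nbhs_nbhs.
Qed.

Section subtype.
Variables (T : topologicalType) (A : set T).

Lemma set_val_continuous : continuous (set_val : A -> T).
Proof. exact: initial_continuous. Qed.

Lemma compact_set_type : compact A -> compact [set: A].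
Proof.
move=> cA F FF _; pose G := (set_val : A -> T) @ F.
have [|a [Aa cla]] := cA G (fmap_proper_filter _ FF).
  by apply: (@filterE _ F _ (set_val @^-1` A)) => x; exact: set_valP.
exists (SigSub (mem_set Aa)); split => // P Q FP [_ [[W oW <-] /= Wa WQ]].
have [||y [[x Px <-] Wx]] := cla ((set_val : A -> T) @` P) W.
- by rewrite /G; apply: (@filterS _ F _ P) => // x Px; exists x.
- by apply: open_nbhs_nbhs; split.
exists x; split => //; exact: WQ.
Qed.

Lemma zero_dimensional_set_type : zero_dimensional T -> zero_dimensional A.
Proof.
move=> zT x y xy; have [U [cU Ux Uy]] : exists U : set T,
    [/\ clopen U, U (set_val x) & ~ U (set_val y)].
  by apply: zT; apply: contra_neq xy; exact: val_inj.
exists (set_val @^-1` U); split => //; apply: preimage_clopen => //.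
exact: set_val_continuous.
Qed.

End subtype.

Lemma zero_dimensional_hausdorff (T : topologicalType) :
  zero_dimensional T -> hausdorff_space T.
Proof.
move=> zT x y cl; apply/eqP/negPn/negP => /zT [U [[oU cU] Ux nUy]].
have [|//|z [Uz /(_ Uz)//]] := cl U (~` U); first exact: open_nbhs_nbhs.
by apply: open_nbhs_nbhs; split => //; rewrite openC.
Qed.

(** Compactness and zero-dimensionality pass from the ambient space to [A], so only the absence of
    isolated points remains as a hypothesis. *)
Lemma homeomorphism_cantor_set_type (R : realType)
    (A : set (tree_of (fun _ : nat => bool))) :
  A !=set0 -> closed A -> (forall x : A, ~ open [set x]) ->
  exists f : cantor_space -> A, homeomorphism f.
Proof.
move=> [a Aa] cA nA.
pose T : pseudoPMetricType R :=
  HB.pack (set_type A) (PseudoMetric.on (set_type A))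
    (isPointed.Build (set_type A) (SigSub (mem_set Aa))).
have zT : zero_dimensional T.
  apply: zero_dimensional_set_type; apply: zero_dimension_prod => _.
  exact: discrete_zero_dimension.
have [_ cK _ _] : cantor_like (tree_of (fun _ : nat => bool)).
  apply: cantor_like_finite_prod => _; first exact: (@finite_finset bool).
  by exists (true, false).
have cT : cantor_like T.
  split => //; last exact: zero_dimensional_hausdorff.
    exact/perfectTP.
  by apply: compact_set_type; exact: (subclosed_compact cA cK).
have [f [cf clf]] := homeomorphism_cantor_like cT.
exists f; split; first exact: cf.
exists f^-1%FUN; split.
(* The inverse is continuous because [f] is a closed map. *)
- apply/continuous_closedP => C cC.
  suff -> : f^-1%FUN @^-1` C = f @` C by apply: clf.
  apply/seteqP; split => [x Cx|_ [c Cc <-]] /=; last by rewrite funK ?inE.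
  by exists (f^-1%FUN x) => //; rewrite invK ?inE.
- by move=> x; rewrite funK ?inE.
- by move=> x; rewrite invK ?inE.
Qed.

(** * The l1-norm against the vague topology *)

Section l1norm.
Variables (R : realType) (G : groupType).
Implicit Types (u v w : G -> R) (p q : prob_measure R G) (g : G).

Lemma l1norm_ge0 u : (0 <= l1norm u)%E.
Proof. by apply: esum_ge0 => h _; rewrite lee_fin. Qed.

Lemma l1norm_distC u v :
  l1norm (fun h => u h - v h) = l1norm (fun h => v h - u h).
Proof. by apply: eq_esum => h _; rewrite distrC. Qed.

Lemma l1norm_triangle u v w :
  (l1norm (fun h => (u h - w h)%R)
     <= l1norm (fun h => (u h - v h)%R) + l1norm (fun h => (v h - w h)%R))%E.
Proof.
rewrite /l1norm -esumD => [|h _|h _]; rewrite ?lee_fin//.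
by apply: le_esum => h _; rewrite -EFinD lee_fin ler_distD.
Qed.

Lemma l1norm_translate g p q :
  l1norm (fun h => translate g p h - translate g q h)
    = l1norm (fun h => p h - q h).
Proof.
apply/esym; rewrite /l1norm.
rewrite (@reindex_esum R G G [set: G] [set: G] (fun h => g^-1 * h)%g)//.
split=> // [x y _ _|y _]; first exact: mulgI.
by exists (g * y)%g => //; rewrite mulKg.
Qed.

(** Evaluation at [h] is the pairing with the indicator of [h], which has finite support. *)
Lemma mass_continuous h : continuous (fun p => p h).
Proof.
have fin1 : finite_set [set k | ((k == h)%:R : R) != 0].
  apply: (@sub_finite_set _ _ [set h]) => // k /=.
  by case: (eqVneq k h) => [->|_] //; rewrite eqxx.
pose f : Cc R G := exist _ (fun k => (k == h)%:R) fin1.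
have -> : (fun p => p h) = proj f \o (@pairing R G).
  apply/funext => p /=; rewrite /proj /pairing /=.
  rewrite -(fsbig_widen [set h] setT) //=.
    by rewrite fsbig_set1 eqxx mul1r.
  by move=> k [_ /= /eqP/negPf ->]; rewrite mul0r.
move=> p; apply: continuous_comp; first exact: initial_continuous.
exact: prod_topology_proj_continuous.
Qed.

(* Scheffe's lemma: most of the mass of p sits on a finite set F, where q is
   close to p pointwise, so q has little mass left outside F. *)
Lemma vague_l1_near p (e : R) :
  0 < e -> \forall q \near p,
    (l1norm (fun h => (p h - (q : prob_measure R G) h)%R) <= e%:E)%E.
Proof.
move=> e0.
(* The error [e] is split into [e / 2] on [F] and [e / 4] for the tail of each measure. *)
have : ((1 - e / 4)%:E < \esum_(h in [set: G]) (p h)%:E)%E.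
  by rewrite pmass_sum lte_fin; lra.
move=> /ereal_sup_gt[_ [F [finF _] <-]].
rewrite fsbig_finite//= sumEFin lte_fin => pF.
have ae : (fun q => \sum_(i <- fset_set F) q i) @ p -->
    \sum_(i <- fset_set F) p i.
  apply: (cvg_big (@add_continuous R) (nbhs_filter p)) => h _.
  exact: mass_continuous.
have be : (fun q => \sum_(i <- fset_set F) `|p i - q i|) @ p -->
    \sum_(i <- fset_set F) `|p i - p i|.
  apply: (cvg_big (@add_continuous R) (nbhs_filter p)) => h _.
  apply: cvg_norm; apply: cvgB; first exact: cvg_cst.
  exact: mass_continuous.
rewrite [X in _ --> X]big1 in be; last by move=> h _; rewrite subrr normr0.
have tail q : 1 - e / 4 < \sum_(i <- fset_set F) q i ->
    (\esum_(h in ~` F) (q h)%:E <= (e / 4)%:E)%E.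
  move=> qF; have := pmass_sum q.
  have q0 h : (0 <= (q h)%:E)%E by rewrite lee_fin; have /andP[] := pmass_itv q h.
  rewrite (esumID F)// setTI setTI esum_fset// fsbig_finite//= sumEFin => E.
  have : (((1 - e / 4)%:E + \esum_(h in ~` F) (q h)%:E)%E <= 1)%E.
    by rewrite -[leRHS]E leeD2r// lee_fin ltW.
  case: (\esum_(h in _) _)%E (esum_ge0 (fun h (_ : (~` F) h) => q0 h)) => [r _|_|//].
    by rewrite -EFinD !lee_fin; lra.
  by rewrite addey.
near=> q.
have q1 : 1 - e / 4 < \sum_(i <- fset_set F) q i.
  by near: q; apply: (cvgr_gt _ ae).
have q2 : \sum_(i <- fset_set F) `|p i - q i| < e / 2.
  by near: q; apply: (cvgr_lt _ be); lra.
rewrite /l1norm (esumID F)// !setTI esum_fset// fsbig_finite//= sumEFin.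
have le1 : (\esum_(h in ~` F) (`|p h - q h|)%:E <= (e / 4)%:E + (e / 4)%:E)%E.
  apply: le_trans (leeD (tail p pF) (tail q q1)).
  have m0 r h : (0 <= ((r : prob_measure R G) h)%:E)%E.
    by rewrite lee_fin; have /andP[] := pmass_itv r h.
  rewrite -esumD => [|h _|h _]//; apply: le_esum => h _.
  rewrite -EFinD lee_fin; have := m0 p h; have := m0 q h; rewrite !lee_fin.
  by move=> *; rewrite (le_trans (ler_normB _ _))// !ger0_norm.
apply: (le_trans (leeD (_ : _ <= (e / 2)%:E)%E le1)); first by rewrite lee_fin ltW.
by rewrite -!EFinD lee_fin; lra.
Unshelve. all: by end_near. Qed.

End l1norm.

(** Compactness is used through near coverings, with the filter of finite sequences ordered by
    inclusion: near [x], every sequence containing [x] will do. *)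
Lemma finite_l1_net (R : realType) (G : groupType) (X : topologicalType)
    (b : X -> prob_measure R G) (x0 : X) (e : R) :
  compact [set: X] -> continuous b -> 0 < e ->
  exists s : seq X, forall x, exists2 k : nat, (k < size s)%N &
    (l1norm (fun h => (b x h - b (nth x0 s k) h)%R) <= e%:E)%E.
Proof.
move=> /compact_near_coveringP cX cb e0.
pose F : set_system (seq X) :=
  filter_from [set: seq X] (fun s => [set t : seq X | {subset s <= t}]).
have FF : Filter F.
  apply: filter_from_filter; first by exists [::].
  move=> s t _ _; exists (s ++ t) => // r sub; split => x xs; apply: sub;
    by rewrite mem_cat xs ?orbT.
pose P (s : seq X) x := exists2 k : nat, (k < size s)%N &
    (l1norm (fun h => (b x h - b (nth x0 s k) h)%R) <= e%:E)%E.
have [x _|s _ sP] := cX _ F P FF.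
  exists ([set y | (l1norm (fun h => (b x h - b y h)%R) <= e%:E)%E],
          [set t : seq X | {subset [:: x] <= t}]) => /=.
    by split; [exact: (cb x _ (vague_l1_near _ _ _ _ e0))|exists [:: x]].
  move=> [y t] [/= xy xt]; have /(nthP x0)[k kt tk] := xt x (mem_head _ _).
  by exists k => //; rewrite tk l1norm_distC.
by exists s => x; apply: (sP s).
Qed.

(** * Enumerations and transport of actions *)

Lemma countable_infinite_bijective_nat (T : choiceType) :
  countable [set: T] -> infinite_set [set: T] ->
  exists (e : nat -> T) (d : T -> nat), cancel e d /\ cancel d e.
Proof.
move=> cT /infiniteP iT.
have : ([set: T] #= [set: nat])%card by rewrite card_eq_le iT andbT.
by move=> /card_set_bijP[d]; rewrite setTT_bijective => -[e de ed]; exists e, d.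
Qed.

Lemma continuous_action_by_homeomorphisms (G : groupType) (X : topologicalType)
    (act : G -> X -> X) :
  (forall x, act 1%g x = x) ->
  (forall g h x, act (g * h)%g x = act g (act h x)) ->
  (forall g, continuous (act g)) -> action_by_homeomorphisms act.
Proof.
move=> a1 aM ac; split => // g; split; first exact: ac.
by exists (act g^-1%g); split => [|x|x]; rewrite -?aM ?mulVg ?mulgV.
Qed.

(** Conjugate by [f]; as [f] is onto, the suprema are taken over the same sets. *)
Lemma amenable_action_transport (R : realType) (G : groupType)
    (X Y : topologicalType) (f : Y -> X) (act : G -> X -> X) :
  homeomorphism f -> action_by_homeomorphisms act -> amenable_action R act ->
  exists act' : G -> Y -> Y,
    action_by_homeomorphisms act' /\ amenable_action R act'.
Proof.
move=> [cf [f' [cf' fK f'K]]] [a1 aM ah] [b [cb bG]].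
exists (fun g y => f' (act g (f y))); split.
  apply: continuous_action_by_homeomorphisms => [y|g h y|g y].
  - by rewrite a1 fK.
  - by rewrite aM f'K.
  - apply: continuous_comp; last exact: cf'.
    by apply: continuous_comp; [exact: cf|have [ag _] := ah g; exact: ag].
exists (fun n y => b n (f y)); split => [n y|g].
  by apply: continuous_comp; [exact: cf|exact: cb].
apply: cvg_trans (bG g); apply: near_eq_cvg; apply: nearW => n; congr ereal_sup.
apply/seteqP; split => _ [x _ <-] /=.
  by exists (f' x) => //; rewrite !f'K.
by exists (f x) => //; rewrite f'K.
Qed.

(** * Convergence of bit sequences *)

Notation bits := (tree_of (fun _ : nat => bool)).

Lemma bits_near (y : bits) (i : nat) : \forall z \near y, (z : nat -> bool) i = y i.
Proof.
apply: (@prod_topology_proj_continuous nat (fun _ => discrete_topology bool) i y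
  [set y i]).
exact: discrete_set1.
Qed.

Lemma bits_near_seq (y : bits) (c : nat -> nat) (m : nat) :
  \forall z \near y, forall k, (k < m)%N -> (z : nat -> bool) (c k) = y (c k).
Proof.
elim: m => [|m IH]; first exact: (@filterE _ _ (nbhs_filter y)).
apply: (@filterS2 _ _ (nbhs_filter y) _ _ _ _ IH (bits_near y (c m))).
by move=> z IHz zm k; rewrite ltnS leq_eqVlt => /predU1P[->|/IHz].
Qed.

Lemma bits_cvg (F : set_system bits) (y : bits) : Filter F ->
  (forall i, \forall z \near F, (z : nat -> bool) i = y i) -> F --> y.
Proof.
move=> FF Fy; apply: (@cvg_prod_topology nat (fun _ => discrete_topology bool)) => i.
by apply: (@cvg_near_cst _ (discrete_topology bool)); exact: Fy.
Qed.

(** * The shift action on almost equivariant bit sequences *)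

Section cantor_action.
Variables (R : realType) (G : groupType) (X : topologicalType).
Variables (act : G -> X -> X) (b : nat -> X -> prob_measure R G) (x0 : X).
Variables (e : nat -> G * nat * nat) (d : G * nat * nat -> nat).
Hypotheses (eK : cancel e d) (dK : cancel d e).
Hypothesis aM : forall g h x, act (g * h)%g x = act g (act h x).
Variable s : nat -> seq X.
Hypothesis sP : forall n x, exists2 k : nat, (k < size (s n))%N &
  (l1norm (fun h => (b n x h - b n (nth x0 (s n) k) h)%R) <= (n.+1%:R^-1)%:E)%E.

(** The error of [b] itself plus two net errors, one for each measure replaced by a net point. *)
Let eps (n : nat) (g : G) : \bar R :=
  (ereal_sup [set l1norm (fun h => (translate g (b n x) h - b n (act g x) h)%R)
               | x in [set: X]] + (n.+1%:R^-1)%:E + (n.+1%:R^-1)%:E)%E.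

(* The n-th measure is the net point whose position in [s n] is the first bit
   set; the bits past [size (s n)] are never read. *)
Let dec (n : nat) (u : nat -> bool) : prob_measure R G :=
  b n (nth x0 (s n) (find u (iota 0 (size (s n))))).

Let dec_ext n u v :
  (forall k, (k < size (s n))%N -> u k = v k) -> dec n u = dec n v.
Proof.
move=> uv; congr (b n (nth _ _ _)); apply: eq_in_find => k.
by rewrite mem_iota => /uv.
Qed.

(** Every bit sequence decodes: if no bit that is read is set, [find] returns the length and [nth]
    falls back on [x0]. *)
Let mu (y : bits) (g : G) (n : nat) := dec n (fun k => y (d (g, n, k))).

Let mu_near y g n : \forall z \near y, mu z g n = mu y g n.
Proof.
have := bits_near_seq y (fun k => d (g, n, k)) (size (s n)).
by apply: filterS => z zy; exact: dec_ext.
Qed.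

(** Each condition reads finitely many bits, whence closedness; the bound does not depend on [h],
    whence invariance under [shift]. *)
Let A : set bits := [set y | forall g h n,
  (l1norm (fun k => (translate g (mu y h n) k - mu y (g * h)%g n k)%R)
    <= eps n g)%E].

Let A_closed : closed A.
Proof.
move=> y cly g h n.
have [z [Az [<- <-]]] : A `&` [set z | mu z h n = mu y h n /\
    mu z (g * h)%g n = mu y (g * h)%g n] !=set0.
  by apply: cly; apply: filterI; exact: mu_near.
exact: Az.
Qed.

Let orbit_bits : bits := fun i => let: (g, n, k) := e i in
  `[< (l1norm (fun h => (b n (act g x0) h - b n (nth x0 (s n) k) h)%R)
       <= (n.+1%:R^-1)%:E)%E >].

Let orbit_bitsP g n :
  (l1norm (fun h => (b n (act g x0) h - mu orbit_bits g n h)%R)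
     <= (n.+1%:R^-1)%:E)%E.
Proof.
rewrite /mu /dec; pose u k := orbit_bits (d (g, n, k)).
have uE k : u k = `[< (l1norm (fun h =>
    (b n (act g x0) h - b n (nth x0 (s n) k) h)%R) <= (n.+1%:R^-1)%:E)%E >].
  by rewrite /u /orbit_bits dK.
have hu : has u (iota 0 (size (s n))).
  have [k kn bk] := sP n (act g x0).
  by apply/hasP; exists k; [rewrite mem_iota|rewrite uE; exact/asboolP].
have := nth_find 0%N hu; rewrite nth_iota ?add0n; last first.
  by move: hu; rewrite has_find size_iota.
by rewrite [u _]uE => /asboolP.
Qed.

Let A_orbit_bits : A orbit_bits.
Proof.
move=> g h n; rewrite /eps.
(* The path goes from the translated code at [h] to the true measure at [h], then to the one at
   [g * h], then to its code. *)
apply: le_trans (l1norm_triangle _ _ _ (b n (act (g * h)%g x0)) _) _.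
apply: leeD; last exact: orbit_bitsP.
apply: le_trans (l1norm_triangle _ _ _ (translate g (b n (act h x0))) _) _.
rewrite [leRHS]addeC; apply: leeD.
  by rewrite l1norm_translate l1norm_distC; exact: orbit_bitsP.
by apply: ereal_sup_ubound; exists (act h x0) => //; rewrite aM.
Qed.

Let A_perfect (y : A) : ~ open [set y].
Proof.
move=> oy.
pose N := size (s 0%N).
(* Flipping a bit that is never read gives points of A converging to y. *)
pose flip (m : nat) : bits := fun i =>
  if i == d (1%g, 0%N, (N + m)%N) then ~~ (set_val y : nat -> bool) i
  else (set_val y : nat -> bool) i.
have mu_flip m g n : mu (flip m) g n = mu (set_val y) g n.
  apply: dec_ext => k kn; rewrite /flip; case: eqP => // /(can_inj dK)[_ n0 kE].
  by move: kn; rewrite kE n0 ltnNge leq_addr.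
have Aflip m : A (flip m).
  by move=> g h n; rewrite !mu_flip; exact: (set_valP y).
have flip_cvg : flip @ \oo --> (set_val y : bits).
  apply: bits_cvg => i; rewrite !near_simpl.
  have [[[g n] k] iE] : exists j, i = d j by exists (e i).
  (* The bit of index [(g, n, k)] can only be flipped when [k = N + m], hence never once [m > k]. *)
  near=> m; rewrite /flip iE; case: eqP => // /(can_inj dK)[_ _ kE].
  have : (k < m)%N by near: m; exact: nbhs_infty_gt.
  by rewrite kE ltnNge leq_addl.
(* If [y] is isolated, some open [W] meets [A] in [y] alone, and the flipped points end up in
   [W]. *)
have : \forall m \near \oo, flip m = set_val y.
  have [W oW Wy] := oy.
  have : nbhs (set_val y : bits) W.
    apply: open_nbhs_nbhs; split => //.
    by rewrite -[W _]/((set_val @^-1` W) y) Wy.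
  move=> /flip_cvg; rewrite nbhs_simpl /=; apply: (@filterS _ \oo) => m Wm.
  suff : [set y] (SigSub (mem_set (Aflip m))) by move=> /= <-.
  by rewrite -Wy.
move=> [m _ /(_ m (leqnn m))].
move=> /(congr1 (fun z => z (d (1%g, 0%N, (N + m)%N)))).
by rewrite /flip eqxx; case: (set_val y _).
Unshelve. all: by end_near. Qed.

(** Right translation of the argument, so that [shift] is a left action. *)
Let shift (g : G) (y : bits) : bits := fun i =>
  let: (h, n, k) := e i in (y : nat -> bool) (d ((h * g)%g, n, k)).

Let mu_shift g y h n : mu (shift g y) h n = mu y (h * g)%g n.
Proof. by apply: dec_ext => k _; rewrite /shift dK. Qed.

Let A_shift g (y : A) : A (shift g (set_val y)).
Proof.
move=> k h n; rewrite !mu_shift -mulgA; exact: (set_valP y).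
Qed.

Let sact (g : G) (y : A) : A := SigSub (mem_set (A_shift g y)).

Let sact_continuous g : continuous (sact g).
Proof.
apply: continuous_comp_initial => y.
apply: (bits_cvg _ _ (@fmap_filter _ _ _ _ (nbhs_filter y))) => i.
rewrite !near_simpl.
case iE : (e i) => [[h n] k].
apply: (@filterS _ _ (nbhs_filter y) _ _ _
  (@set_val_continuous _ A y _ (bits_near (set_val y) (d ((h * g)%g, n, k))))).
by move=> z /=; rewrite !set_valE /= /shift iE.
Qed.

Let sact_homeo : action_by_homeomorphisms sact.
Proof.
apply: continuous_action_by_homeomorphisms => [y|g h y|]//.
  apply: val_inj; apply/funext => i; rewrite /= /shift.
  case iE : (e i) => [[h n] k].
  by rewrite mulg1 -iE eK.
apply: val_inj; apply/funext => i; rewrite /= /shift.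
by case: (e i) => [[k n] j]; rewrite !set_valE /= /shift dK mulgA.
Qed.

Let sact_amenable :
  (forall g : G, (fun n => ereal_sup
     [set l1norm (fun h => translate g (b n x) h - b n (act g x) h)
        | x in [set: X]]) @ \oo --> (0 : \bar R)%E) ->
  amenable_action R sact.
Proof.
move=> bG; exists (fun n y => mu (set_val y) 1%g n); split => [n y|g].
  apply: (@cvg_near_cst _ _ _ _ _ (nbhs_filter y)).
  exact: (@set_val_continuous _ A y _ (mu_near (set_val y) 1%g n)).
have eps0 : eps^~ g @ \oo --> (0 : \bar R)%E.
  rewrite -[X in _ --> X]adde0 -[X in _ --> (X + _)%E]adde0.
  have inv0 : (fun n => (n.+1%:R^-1)%:E) @ \oo --> (0 : \bar R)%E.
    by apply/fine_cvgP; split; [exact: nearW|exact: cvg_harmonic].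
  by apply: cvgeD => //; apply: cvgeD.
apply: squeeze_cvge (cvg_cst _) eps0; apply: nearW => n; apply/andP; split.
  (* The supremum is nonnegative because [A] has a point. *)
  apply: le_trans (l1norm_ge0 _ _ _) _; apply: ereal_sup_ubound.
  by exists (SigSub (mem_set A_orbit_bits)).
apply: ge_ereal_sup => _ [y _ <-].
(* Evaluating the shifted point at 1 reads [y] at [g * 1], which is the defining condition of [A]
   with [h = 1]. *)
have -> : mu (set_val (sact g y)) 1%g n = mu (set_val y) (g * 1)%g n.
  by rewrite mulg1 -{2}[g]mul1g; exact: mu_shift.
exact: (set_valP y).
Qed.

Lemma cantor_action_of_net :
  (forall g : G, (fun n => ereal_sup
     [set l1norm (fun h => translate g (b n x) h - b n (act g x) h)
        | x in [set: X]]) @ \oo --> (0 : \bar R)%E) ->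
  exists act' : G -> cantor_space -> cantor_space,
    action_by_homeomorphisms act' /\ amenable_action R act'.
Proof.
move=> bG.
have [f hf] := homeomorphism_cantor_set_type R A
  (ex_intro _ _ A_orbit_bits) A_closed A_perfect.
exact: (amenable_action_transport _ _ _ _ f sact hf sact_homeo (sact_amenable bG)).
Qed.

End cantor_action.

(** * The equivalence *)

Theorem mainTheorem4 (R : realType) (G : groupType)
    (hG : countable [set: G]) :
  amenable_at_infinity R G <->
  exists act : G -> cantor_space -> cantor_space,
    action_by_homeomorphisms act /\ amenable_action R act.
Proof.
split=> [[X [act [[x0 _] cX _ [_ aM _] [b [cb bG]]]]]|[act [hact aact]]]; last first.
  exists cantor_space, act; split => //.
  - by exists point.
  - exact: cantor_space_compact.
  - exact: cantor_space_hausdorff.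
have inv_gt0 n : 0 < (n.+1%:R^-1 : R) by rewrite invr_gt0.
have /choice[s sP] :=
  fun n => finite_l1_net R G X (b n) x0 _ cX (cb n) (inv_gt0 n).
(* The factors [nat] make the index set infinite even when [G] is finite. *)
have [e [d [eK dK]]] : exists (e : nat -> G * nat * nat) d,
    cancel e d /\ cancel d e.
  apply: countable_infinite_bijective_nat.
    rewrite -setXTT; apply: countableX; last exact: countableP.
    by rewrite -setXTT; apply: countableX; last exact: countableP.
  move=> /(finite_image snd); rewrite (_ : _ @` _ = setT); first exact: infinite_nat.
  by apply/seteqP; split => // n _; exists (1%g, 0%N, n).
exact: (cantor_action_of_net R G X act b x0 e d eK dK aM s sP bG).
Qed.
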